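(* For $n\in\mathbb{N}$, $n\ge1$, let $H_n=G_n/\sqrt n$ and let $Q_n(x)=\mathbb{P}(H_n\le x)$ be its cumulative distribution function. As $n\to\infty$, the sequence $(H_n)_{n\in\mathbb{N}}$ converges weakly (in distribution) to a random variable with cumulative distribution function $$R(x)=\begin{cases}1-\exp(-x^2/2), & x\ge 0,\\ 0, & x<0,\end{cases}$$ (the Rayleigh distribution with scale parameter $1$); that is, $$\lim_{n\to\infty}Q_n(x)=1-\exp(-x^2/2)\quad\text{for all } x\ge 0.$$
   Context: Let $X_1,X_2,\ldots$ be independent random variables, each uniformly distributed on $\{1,2,\ldots,n\}$. The gain is $G_n=\min\{k\in\{1,\ldots,n\}: X_k\le k\}$ (well defined since $X_n\le n$). Its probability mass function is $p_{k,n}=\mathbb{P}(G_n=k)=\frac{k}{n^k}\cdot\frac{(n-1)!}{(n-k)!}$ for $1\le k\le n$. Explicitly, for $x\ge0$ and $\chi=\lfloor x\sqrt n\rfloor\le n-1$, one has $Q_n(x)=1-\frac{(n-1)!}{n^{\chi}(n-1-\chi)!}$, and $Q_n(x)=1$ if $\chi\ge n$. *)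

(* Defs.v *)
From HB Require Import structures.
From mathcomp Require Import all_boot all_order all_algebra finmap.
From mathcomp Require Import all_classical all_reals all_analysis.

Set Implicit Arguments.
Unset Strict Implicit.
Unset Printing Implicit Defensive.

Import Order.TTheory GRing.Theory Num.Theory.
Import numFieldNormedType.Exports.

Local Open Scope classical_set_scope.
Local Open Scope ring_scope.

Definition mutually_independent d d' (T : measurableType d)
    (T' : measurableType d') (R : realType) (P : probability T R)
    (I : choiceType) (D : set I) (X : I -> {RV P >-> T'}) :=
  forall (s : {fset I}) (A : I -> set T'),
    [set` s] `<=` D -> (forall i, i \in s -> measurable (A i)) ->
    P (\bigcap_(i in [set` s]) (X i @^-1` A i)) =
    (\prod_(i <- s) P (X i @^-1` A i))%E.

Definition uniform_upto d (T : measurableType d) (R : realType)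
    (P : probability T R) (n : nat) (X : {RV P >-> nat}) :=
  forall j : nat,
    distribution P X [set j] = (if (1 <= j <= n)%N then n%:R^-1 else 0)%:E.

(* The default value n does not alter the minimum when some k in {1, ..., n}
   satisfies x k <= k; under the uniform law this holds almost surely, since
   x n <= n. *)
Definition gain (n : nat) (x : nat -> nat) : nat :=
  \big[Order.min/n]_(1 <= k < n.+1 | (x k <= k)%N) k.

Section normalized_gain.
Context d (T : measurableType d) (R : realType) (P : probability T R).

Lemma measurable_nat2 (f : nat -> nat -> nat) (X Y : T -> nat) :
  measurable_fun setT X -> measurable_fun setT Y ->
  measurable_fun setT (fun w => f (X w) (Y w)).
Proof.
move=> mX mY _ A _; rewrite setTI.
rewrite (_ : _ @^-1` A = \bigcup_i \bigcup_(j in [set j | A (f i j)])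
    (X @^-1` [set i] `&` Y @^-1` [set j])); last first.
  apply/seteqP; split => [w Aw|w [i _ [j Aij [/= Xi Yj]]]].
    by exists (X w) => //; exists (Y w).
  by rewrite /= Xi Yj.
apply: bigcup_measurable => i _; apply: bigcup_measurable => j _.
by apply: measurableI; rewrite -[X in measurable X]setTI; [exact: mX|exact: mY].
Qed.

Variables (n : nat) (X : nat -> {RV P >-> nat}).

Definition normalized_gain_fun (w : T) : R :=
  (gain n (fun k => X k w))%:R / Num.sqrt n%:R.

Lemma measurable_normalized_gain : measurable_fun setT normalized_gain_fun.
Proof.
have mg : measurable_fun setT (fun w => gain n (fun k => X k w)).
  rewrite /gain; elim: (index_iota 1 n.+1) => [|k s ih].
    by under eq_fun do rewrite big_nil; exact: measurable_cst.
  under eq_fun do rewrite big_cons.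
  exact: (@measurable_nat2 (fun i j => if (i <= k)%N then Order.min k j else j)).
apply: (measurableT_comp (f := fun m : nat => m%:R / Num.sqrt n%:R : R)) mg.
by [].
Qed.

HB.instance Definition _ :=
  isMeasurableFun.Build _ _ _ _ normalized_gain_fun measurable_normalized_gain.

Definition normalized_gain : {RV P >-> R} := normalized_gain_fun.

End normalized_gain.

Definition rayleigh_cdf (R : realType) (x : R) : R :=
  if 0 <= x then 1 - expR (- (x ^+ 2 / 2)) else 0.

Definition converges_in_distribution (R : realType)
    (d : nat -> measure_display) (T : forall n, measurableType (d n))
    (P : forall n, probability (T n) R) (Y : forall n, {RV P n >-> R})
    d' (T' : measurableType d') (P' : probability T' R) (Z : {RV P' >-> R}) :=
  forall x : R, {for x, continuous (cdf Z)} ->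
    cdf (Y n) x @[n --> \oo] --> cdf Z x.

(* Main.v *)
(* For m < n the event G_n > m says that X_k > k for all k <= m, so by
   independence its probability is \prod_(1 <= k <= m) (1 - k/n).  From
   exp (- y) <= 1 / (1 + y) and 1 - y <= exp (- y) one gets, for k <= m,
     exp (- k / (n - m)) <= 1 - k/n <= exp (- k / n),
   and with m = floor (x sqrt n) both resulting bounds of the product,
   exp (- m (m + 1) / (2 (n - m))) and exp (- m (m + 1) / (2 n)), tend to
   exp (- x^2 / 2). *)
Require Import Defs.
From HB Require Import structures.
From mathcomp Require Import all_boot all_order all_algebra finmap.
From mathcomp Require Import lra ring.
From mathcomp Require Import all_classical all_reals all_analysis.

Set Implicit Arguments.
Unset Strict Implicit.
Unset Printing Implicit Defensive.

Import Order.TTheory GRing.Theory Num.Theory.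
Import numFieldNormedType.Exports.

Local Open Scope classical_set_scope.
Local Open Scope ring_scope.

(** * The exact distribution of the gain *)

Lemma ltn_gain (n m : nat) (x : nat -> nat) : (m < n)%N ->
  (m < gain n x)%N = all (fun k => k < x k)%N (index_iota 1 m.+1).
Proof.
move=> mn.
(* Stated for an arbitrary list to allow induction; on the empty list the minimum is the default
   [n], which exceeds [m] by [mn]. *)
have H s : (m < \big[Order.min/n]_(k <- s | (x k <= k)%N) k)%N =
    all (fun k => (x k <= k)%N ==> (m < k)%N) s.
  elim: s => [|k s ih]; first by rewrite big_nil.
  rewrite big_cons /= -ih; case: (x k <= k)%N => //=.
  exact: (@lt_min _ nat).
rewrite /gain H; apply/allP/allP => /= h k; rewrite mem_index_iota => /andP[k1 km].
  have := h k; rewrite mem_index_iota k1 (leq_trans km (leqW mn)) => /(_ isT).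
  by rewrite (leqNgt (x k)) [(m < k)%N]ltnNge; move: km; rewrite ltnS => -> /=; rewrite implybF negbK.
apply/implyP => xk; rewrite ltnNge; apply/negP => kmm.
by have := h k; rewrite mem_index_iota k1 ltnS kmm => /(_ isT); rewrite ltnNge xk.
Qed.

Lemma gain_le (n : nat) (x : nat -> nat) : (gain n x <= n)%N.
Proof.
by rewrite /gain; elim/big_rec: _ => // k y _ yn; rewrite -leEnat ge_min leEnat yn orbT.
Qed.

Section gain_distribution.
Context d (T : measurableType d) (R : realType) (P : probability T R).
Variable n : nat.

(** By induction on [k]: the value 0 carries no mass, and each further value up to [n] adds an atom
    of mass 1/n. *)
Lemma uniform_upto_le (Y : {RV P >-> nat}) (k : nat) :
  uniform_upto n Y -> (k <= n)%N ->
  P (Y @^-1` [set j | (j <= k)%N]) = (k%:R / n%:R)%:E.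
Proof.
move=> hY; rewrite -[LHS]/(distribution P Y _).
elim: k => [_|k ih kn].
  rewrite (_ : [set _ | _] = [set 0%N]); first by rewrite hY /= mul0r.
  by apply/seteqP; split => j /=; rewrite leqn0 => /eqP.
rewrite (_ : [set _ | _] = [set j | (j <= k)%N] `|` [set k.+1]); last first.
  apply/seteqP; split => j /=.
    by rewrite leq_eqVlt ltnS => /orP[/eqP|]; [right|left].
  by move=> [/leqW|->].
transitivity (distribution P Y [set j | (j <= k)%N] + distribution P Y [set k.+1])%E.
  apply: measureU => //.
  by apply/seteqP; split => j //= -[/[swap] ->]; rewrite ltnn.
by rewrite ih 1?ltnW// hY /= kn -EFinD -[k.+1 in RHS]addn1 natrD mulrDl mul1r.
Qed.

Lemma probability_ltn_gain (X : nat -> {RV P >-> nat}) (m : nat) :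
  (forall k, (1 <= k)%N -> uniform_upto n (X k)) ->
  mutually_independent [set k | (1 <= k)%N] X ->
  (m < n)%N ->
  P [set w | (m < gain n (fun k => X k w))%N] =
  (\prod_(1 <= k < m.+1) (1 - k%:R / n%:R))%:E.
Proof.
move=> Xu Xi mn.
(* The range 1..m as a finite set, the form in which independence can be applied. *)
pose s : {fset nat} := [fset k in index_iota 1 m.+1]%fset.
have sE k : (k \in s) = (1 <= k <= m)%N by rewrite inE /= mem_index_iota ltnS.
rewrite (_ : [set w | _] =
    \bigcap_(k in [set` s]) (X k @^-1` [set j | (k < j)%N])); last first.
  apply/seteqP; split => w /=; rewrite ltn_gain//.
    by move=> /allP h k /=; rewrite sE => ks; apply: h; rewrite mem_index_iota ltnS.
  move=> h; apply/allP => k; rewrite mem_index_iota ltnS => ks.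
  by apply: h; rewrite /= sE.
rewrite Xi//; last by move=> k /=; rewrite sE => /andP[].
have -> : \prod_(1 <= k < m.+1) (1 - k%:R / n%:R) =
    \prod_(k <- s) (1 - k%:R / n%:R) :> R.
  apply: perm_big; apply: uniq_perm; rewrite ?iota_uniq ?fset_uniq// => k.
  by rewrite sE mem_index_iota ltnS.
rewrite -prodEFin; apply: eq_big_seq => k /=.
rewrite sE => /andP[k1 km].
have -> : X k @^-1` [set j | (k < j)%N] = ~` (X k @^-1` [set j | (j <= k)%N]).
  by apply/seteqP; split => w /=; rewrite ltnNge => /negP.
rewrite probability_setC; last exact: measurable_funPTI.
by rewrite uniform_upto_le ?EFinB//; [exact: Xu|exact: leq_trans km (ltnW mn)].
Qed.

(** The gain is an integer, so it is at most x sqrt n exactly when it is at most the integer part m.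
    For m >= n both sides equal 1, hence a single formula covers all x >= 0. *)
Lemma cdf_normalized_gain (X : nat -> {RV P >-> nat}) (x : R) :
  (1 <= n)%N ->
  (forall k, (1 <= k)%N -> uniform_upto n (X k)) ->
  mutually_independent [set k | (1 <= k)%N] X ->
  0 <= x ->
  cdf (normalized_gain n X) x =
  (1 - \prod_(1 <= k < (Num.trunc (x * Num.sqrt n%:R)).+1)
         (1 - k%:R / n%:R))%:E.
Proof.
move=> n1 Xu Xi x0.
have sn0 : 0 < Num.sqrt n%:R :> R by rewrite sqrtr_gt0 ltr0n.
set m := Num.trunc _.
have -> : cdf (normalized_gain n X) x =
    P (~` [set w | (m < gain n (fun k => X k w))%N]).
  congr (P _); apply/seteqP; split => w /=;
    rewrite in_itv /= /normalized_gain_fun ler_pdivrMr//.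
    by move=> h; apply/negP; rewrite -leqNgt truncn_ge_nat// mulr_ge0// ltW.
  by move=> /negP; rewrite -leqNgt truncn_ge_nat// mulr_ge0// ltW.
have [mn|nm] := ltnP m n.
  rewrite probability_setC; first by rewrite probability_ltn_gain// EFinB.
  (* The complement rule needs a measurable event: it is the preimage of the open ray above m / sqrt
     n under the normalized gain. *)
  have mg : measurable_fun setT (normalized_gain_fun n X).
    exact: measurable_normalized_gain.
  rewrite (_ : [set w | _] =
     normalized_gain_fun n X @^-1` `]m%:R / Num.sqrt n%:R, +oo[); last first.
    by apply/seteqP; split => w /=; rewrite in_itv /= andbT ltr_pM2r ?invr_gt0// ltr_nat.
  by rewrite -[Z in measurable Z]setTI; exact: mg.
rewrite (_ : [set w | _] = set0); last first.
  by apply/seteqP; split => w //=; rewrite ltnNge (leq_trans (gain_le _ _) nm).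
rewrite setC0 probability_setT.
(* for n <= m the factor k = n of the product vanishes *)
rewrite (bigD1_seq n) ?mem_index_iota ?n1 ?ltnS ?iota_uniq//=.
by rewrite divff ?subrr ?mul0r ?subr0// pnatr_eq0 -lt0n.
Qed.

End gain_distribution.

(** * The Rayleigh distribution and a random variable that has it *)

Section rayleigh.
Context {R : realType}.

(** Replacing the case split by a maximum makes monotonicity and continuity follow by
    composition. *)
Lemma rayleigh_cdfE : @rayleigh_cdf R = fun x => 1 - expR (- (Num.max x 0 ^+ 2 / 2)).
Proof.
apply/funext => x; rewrite /rayleigh_cdf; case: leP => x0 //.
by rewrite expr0n /= mul0r oppr0 expR0 subrr.
Qed.

Lemma nondecreasing_rayleigh_cdf : nondecreasing (@rayleigh_cdf R).
Proof.
move=> x y xy; rewrite rayleigh_cdfE lerD2l lerN2 ler_expR lerN2 ler_pM2r//.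
have m0 z : (Num.max z 0 : R) \is Num.nneg by rewrite nnegrE le_max lexx orbT.
by rewrite lerXn2r// ge_max !le_max xy lexx orbT.
Qed.

Lemma continuous_rayleigh_cdf : continuous (@rayleigh_cdf R).
Proof.
move=> x; rewrite rayleigh_cdfE; apply: cvgB; first exact: cvg_cst.
apply: continuous_cvg; first exact: continuous_expR.
apply: cvgN; apply: cvgMl; rewrite expr2.
under eq_fun do rewrite expr2.
by apply: cvgM; apply: continuous_max => //; exact: cvg_cst.
Qed.

Lemma cvg_rayleigh_cdfNy : rayleigh_cdf x @[x --> -oo] --> (0 : R).
Proof.
apply: cvg_near_cst; near=> x.
rewrite /rayleigh_cdf leNgt; suff -> : x < 0 by [].
near: x; exact: nbhs_ninfty_lt.
Unshelve. all: by end_near. Qed.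

Lemma cvg_rayleigh_cdfy : rayleigh_cdf x @[x --> +oo] --> (1 : R).
Proof.
have sqy : (x ^+ 2 / 2 : R) @[x --> +oo%R] --> +oo%R.
  apply/cvgryPge => A; near=> x.
  (* With x >= 1 and x >= 2A one gets x^2 / 2 >= x / 2 >= A. *)
  have x1 : 1 <= x by near: x; exact: nbhs_pinfty_ge.
  have xA : 2 * A <= x by near: x; apply: nbhs_pinfty_ge; exact: num_real.
  nra.
have : (1 - expR (- (x ^+ 2 / 2))) @[x --> +oo] --> (1 - 0 : R).
  apply: cvgB; first exact: cvg_cst.
  by apply: (@cvg_comp _ _ _ _ (fun y => expR (- y)) _ _ _ sqy); exact: cvgr_expR.
rewrite subr0; apply: cvg_trans; apply: near_eq_cvg; near=> x.
rewrite /rayleigh_cdf ifT//; near: x; exact: nbhs_pinfty_ge.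
Unshelve. all: by end_near. Qed.


HB.instance Definition _ := isCumulative.Build R _ R (@rayleigh_cdf R)
  nondecreasing_rayleigh_cdf (right_continuousW continuous_rayleigh_cdf).

HB.instance Definition _ := isCumulativeBounded.Build R 0 1 (@rayleigh_cdf R)
  cvg_rayleigh_cdfNy cvg_rayleigh_cdfy.

(** The witness is the identity on the real line under the Lebesgue-Stieltjes probability generated
    by [rayleigh_cdf]. *)
Lemma exists_rayleigh_RV : exists (d : measure_display) (T : measurableType d)
    (P : probability T R) (Z : {RV P >-> R}),
  forall x, cdf Z x = (rayleigh_cdf x)%:E.
Proof.
exists _, _, (lebesgue_stieltjes_measure (@rayleigh_cdf R)).
eexists => x; exact: cdf_lebesgue_stieltjes_id.
Qed.

End rayleigh.

(** * Exponential bounds for the product and its limit *)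

Section limit.
Context {R : realType}.

(** The exponents sum to c m (m + 1) / 2. The upper bound uses c = 1/n, the lower one c = 1/(n -
    m). *)
Lemma prod_expR_arithmetic (c : R) (m : nat) :
  \prod_(1 <= k < m.+1) expR (- (k%:R * c)) =
  expR (- (m%:R * m.+1%:R * c / 2)).
Proof.
elim: m => [|m ih]; first by rewrite big_nil !mul0r oppr0 expR0.
rewrite big_nat_recr//= ih -expRD; congr expR.
by rewrite -[in RHS](natr1 m.+1) -(natr1 m); field.
Qed.

Lemma prod_1B_le (m n : nat) : (m < n)%N ->
  \prod_(1 <= k < m.+1) (1 - k%:R / n%:R) <=
  expR (- (m%:R * m.+1%:R * n%:R^-1 / 2)) :> R.
Proof.
move=> mn; rewrite -prod_expR_arithmetic big_seq [leRHS]big_seq.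
apply: ler_prod => k; rewrite mem_index_iota ltnS => /andP[_ km].
(* Besides 1 - y <= exp (- y), multiplying the inequalities requires nonnegative factors, that is k
   <= n. *)
rewrite expR_ge1Dx andbT subr_ge0 ler_pdivrMr ?ltr0n ?(leq_trans _ mn)//.
by rewrite mul1r ler_nat (leq_trans km (ltnW mn)).
Qed.

Lemma prod_1B_ge (m n : nat) : (m < n)%N ->
  expR (- (m%:R * m.+1%:R * (n%:R - m%:R)^-1 / 2)) <=
  \prod_(1 <= k < m.+1) (1 - k%:R / n%:R) :> R.
Proof.
move=> mn; rewrite -prod_expR_arithmetic big_seq [leRHS]big_seq.
apply: ler_prod => k; rewrite mem_index_iota ltnS => /andP[_ km].
rewrite expR_ge0/= expRN.
have n0 : 0 < n%:R :> R by rewrite ltr0n (leq_trans _ mn).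
have nm : 0 < n%:R - m%:R :> R by rewrite subr_gt0 ltr_nat.
have k0 : 0 <= k%:R :> R by [].
have km' : k%:R <= m%:R :> R by rewrite ler_nat.
have y0 : 0 < 1 + k%:R / (n%:R - m%:R) :> R.
  by rewrite (@lt_le_trans _ _ 1)// lerDl divr_ge0// ltW.
apply: (@le_trans _ _ (1 + k%:R / (n%:R - m%:R))^-1).
  by rewrite lef_pV2 ?posrE ?expR_gt0// expR_ge1Dx.
rewrite -[leLHS]div1r ler_pdivrMr//.
rewrite -(ler_pM2r n0) -(ler_pM2r nm) mul1r.
set a := n%:R; set b := m%:R; set c := k%:R.
have -> : (1 - c / a) * (1 + c / (a - b)) * a * (a - b) = (a - c) * (a - b + c).
  by field; rewrite !gt_eqF.
(* The right side exceeds [a * (a - b)] by [c * (b - c)], which is nonnegative since 0 <= c <= b. *)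
nra.
Qed.

Let invsqrt (n : nat) : R := (Num.sqrt n%:R)^-1.

Lemma cvg_invsqrt : invsqrt n @[n --> \oo] --> 0.
Proof.
rewrite gtr0_cvgV0; last first.
  by near=> n; rewrite sqrtr_gt0 ltr0n; near: n; exact: nbhs_infty_gt.
apply/cvgryPge => A; near=> n.
(* It suffices that n >= A^2, because sqrt (A^2) = |A| >= A whatever the sign of A. *)
apply: (@le_trans _ _ (Num.sqrt (A ^+ 2))); first by rewrite sqrtr_sqr ler_norm.
by rewrite ler_wsqrtr//; near: n; exact: nbhs_infty_ger.
Unshelve. all: by end_near. Qed.

(** Truncation loses less than 1, hence at most 1 / sqrt n after the division. *)
Lemma cvg_truncn_sqrt (x : R) : 0 <= x ->
  (Num.trunc (x * Num.sqrt n%:R))%:R * invsqrt n @[n --> \oo] --> x.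
Proof.
move=> x0; apply: (@squeeze_cvgr _ _ _ _ (fun n => x - invsqrt n) (fun=> x)).
- near=> n.
  have s0 : 0 < Num.sqrt n%:R :> R.
    by rewrite sqrtr_gt0 ltr0n; near: n; exact: nbhs_infty_gt.
  have /andP[h1 h2] := truncn_itv (mulr_ge0 x0 (ltW s0)).
  rewrite ler_pdivrMr// h1 andbT ler_pdivlMr// mulrBl mulVf ?gt_eqF//.
  by rewrite lerBlDr natr1 ltW.
- by rewrite -[X in _ --> X]subr0; apply: cvgB; [exact: cvg_cst|exact: cvg_invsqrt].
- exact: cvg_cst.
Unshelve. all: by end_near. Qed.

(** With a = m / sqrt n one has m (m + 1) / n = a (a + 1 / sqrt n) and (n - m) / n = 1 - a / sqrt n,
    so both bounds are continuous expressions in two convergent sequences. *)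
Lemma cvg_prod_1B (x : R) : 0 <= x ->
  \prod_(1 <= k < (Num.trunc (x * Num.sqrt n%:R)).+1) (1 - k%:R / n%:R)
    @[n --> \oo] --> expR (- (x ^+ 2 / 2)).
Proof.
move=> x0.
pose a n : R := (Num.trunc (x * Num.sqrt n%:R))%:R * invsqrt n.
have ax : a n @[n --> \oo] --> x by exact: cvg_truncn_sqrt.
have sx := cvg_invsqrt.
have num : a n * (a n + invsqrt n) @[n --> \oo] --> x ^+ 2.
  by rewrite expr2 -[X in _ * X]addr0; apply: cvgM => //; exact: cvgD.
have den : 1 - a n * invsqrt n @[n --> \oo] --> (1 : R).
  rewrite -[X in _ --> X]subr0 -(mulr0 x).
  by apply: cvgB; [exact: cvg_cst|exact: cvgM].
apply: (@squeeze_cvgr _ _ _ _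
  (fun n => expR (- (a n * (a n + invsqrt n) * (1 - a n * invsqrt n)^-1 / 2)))
  (fun n => expR (- (a n * (a n + invsqrt n) / 2)))).
- near=> n.
  have s0 : 0 < Num.sqrt n%:R :> R.
    by rewrite sqrtr_gt0 ltr0n; near: n; exact: nbhs_infty_gt.
  (* Holds eventually since the limit is 1; through [dE] it yields m < n, which both product bounds
     require. *)
  have d0 : 0 < 1 - a n * invsqrt n.
    by near: n; apply: (cvgr_gt (1 : R)) => //.
  have sq : n%:R = Num.sqrt n%:R ^+ 2 :> R by rewrite sqr_sqrtr.
  set s := Num.sqrt n%:R in s0 sq.
  set m := Num.trunc (x * Num.sqrt n%:R).
  have an : a n = m%:R / s by [].
  have dE : 1 - a n * invsqrt n = (n%:R - m%:R) / n%:R.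
    by rewrite an /invsqrt -/s sq; field; rewrite gt_eqF.
  have n0 : 0 < n%:R :> R by rewrite sq exprn_gt0.
  have mn : (m < n)%N.
    by move: d0; rewrite dE pmulr_lgt0 ?invr_gt0// subr_gt0 ltr_nat.
  have nm : n%:R - m%:R != 0 :> R by rewrite subr_eq0 gt_eqF// ltr_nat.
  have numE : a n * (a n + invsqrt n) = m%:R * m.+1%:R * n%:R^-1.
    by rewrite an /invsqrt -/s sq -natr1; field; rewrite gt_eqF.
  rewrite numE prod_1B_le// andbT dE invf_div mulrA divfK ?gt_eqF//.
  exact: prod_1B_ge.
- apply: continuous_cvg; first exact: continuous_expR.
  apply: cvgN; apply: cvgMl.
  rewrite -[X in _ --> X]mulr1 -[X in _ * X]invr1.
  by apply: cvgM => //; apply: cvgV => //; exact: oner_neq0.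
- apply: continuous_cvg; first exact: continuous_expR.
  by apply: cvgN; exact: cvgMl.
Unshelve. all: by end_near. Qed.

End limit.

(** * Convergence in distribution of the normalized gain *)

Theorem proposition5p3 (R : realType) (d : nat -> measure_display)
    (T : forall n, measurableType (d n)) (P : forall n, probability (T n) R)
    (X : forall n, nat -> {RV (P n) >-> nat})
    (X_unif : forall n k, (1 <= n)%N -> (1 <= k)%N -> uniform_upto n (X n k))
    (X_indep : forall n, (1 <= n)%N ->
       mutually_independent [set k | (1 <= k)%N] (X n)) :
  (exists (d' : measure_display) (T' : measurableType d')
      (P' : probability T' R) (Z : {RV P' >-> R}),
    (forall x, cdf Z x = (rayleigh_cdf x)%:E) /\
    converges_in_distribution (fun n => normalized_gain n (X n)) Z) /\
  (forall x : R, 0 <= x ->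
    cdf (normalized_gain n (X n)) x @[n --> \oo] -->
    (1 - expR (- (x ^+ 2 / 2)))%:E).
Proof.
have cvg_ge0 (x : R) : 0 <= x -> cdf (normalized_gain n (X n)) x @[n --> \oo] -->
    (1 - expR (- (x ^+ 2 / 2)))%:E.
  move=> x0; apply: (@cvg_trans _ ((1 - \prod_(1 <= k <
      (Num.trunc (x * Num.sqrt n%:R)).+1) (1 - k%:R / n%:R))%:E @[n --> \oo])).
    apply: near_eq_cvg; near=> n.
    have n1 : (1 <= n)%N by near: n; exact: nbhs_infty_gt.
    by rewrite cdf_normalized_gain//; [move=> k; exact: X_unif|exact: X_indep].
  apply: cvg_EFin; first exact: nearW.
  by apply: cvgB; [exact: cvg_cst|exact: cvg_prod_1B].
split=> //; have [d' [T' [P' [Z Zcdf]]]] := @exists_rayleigh_RV R.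
exists d', T', P', Z; split=> // x _; rewrite Zcdf /rayleigh_cdf.
case: ifPn => [|x0]; first exact: cvg_ge0.
(* For x < 0 every cdf in the sequence vanishes at x, as the normalized gain is nonnegative. *)
rewrite (_ : (fun n => _) = cst 0%E); first exact: cvg_cst.
apply/funext => n; rewrite /cdf /distribution /pushforward/=.
rewrite (_ : _ @^-1` _ = set0) ?measure0//.
apply/seteqP; split => w //=; rewrite in_itv /= => /le_lt_trans.
by rewrite -ltNge in x0 => /(_ _ x0); rewrite /normalized_gain_fun ltNge divr_ge0.
Unshelve. all: by end_near. Qed.
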